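(* Let $(p^+_{n,b})_{n\ge0}$ be the steady-state probabilities that, at a service completion epoch, the departing batch has size $b$ and $n$ customers are in the queue, in the queueing system described in the context. Suppose that the service and vacation time distributions are such that $\sum_{n=0}^\infty p^+_{n,b}x^n=\Lambda(x)/D(x)$ with polynomials $\Lambda$ of degree $L_1$ and $D$ of degree $M_1$, where $D$ has $b$ simple zeros in $|x|\le1$ (which cancel with zeros of $\Lambda$), and its zeros in $|x|>1$ are: multiple zeros $\beta_1,\dots,\beta_m$ with multiplicities $\pi_1,\dots,\pi_m$, and distinct simple zeros $\alpha_1,\dots,\alpha_{M_1-b-\chi}$, where $\chi=\sum_{i=1}^m\pi_i$. (1) If $L_1\ge M_1$, then one can write uniquely $$\sum_{n=0}^{\infty}p^+_{n,b}x^n=\sum_{i=0}^{L_1-M_1}\tau_ix^i+\sum_{k=1}^{M_1-b-\chi}\frac{c_k}{\alpha_k-x}+\sum_{\nu=1}^m\sum_{i=1}^{\pi_\nu}\frac{\zeta_{\nu,i}}{(\beta_\nu-x)^{\pi_\nu-i+1}},$$ where $\sum_{i=0}^{L_1-M_1}\tau_ix^i$ is the quotient of the division of $\Lambda$ by $D$ and $$c_k=-\frac{\Lambda(\alpha_k)}{D'(\alpha_k)},\quad k=1,\dots,M_1-b-\chi,$$ $$\zeta_{\nu,i}=\frac{1}{(\pi_\nu-i)!}\lim_{x\to\beta_\nu}\frac{d^{\,\pi_\nu-i}}{dx^{\,\pi_\nu-i}}\left[\frac{(\beta_\nu-x)^{\pi_\nu}\Lambda(x)}{D(x)}\right],\quad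 \nu=1,\dots,m,\ i=1,\dots,\pi_\nu.$$ Consequently $$p^+_{n,b}=\tau_n+\sum_{k=1}^{M_1-b-\chi}\frac{c_k}{\alpha_k^{n+1}}+\sum_{\nu=1}^m\sum_{i=1}^{\pi_\nu}\binom{\pi_\nu+n-i}{\pi_\nu-i}\frac{\zeta_{\nu,i}}{\beta_\nu^{\pi_\nu+n+1-i}},\quad 0\le n\le L_1-M_1,$$ $$p^+_{n,b}=\sum_{k=1}^{M_1-b-\chi}\frac{c_k}{\alpha_k^{n+1}}+\sum_{\nu=1}^m\sum_{i=1}^{\pi_\nu}\binom{\pi_\nu+n-i}{\pi_\nu-i}\frac{\zeta_{\nu,i}}{\beta_\nu^{\pi_\nu+n+1-i}},\quad n>L_1-M_1.$$ (2) If $L_1<M_1$, then the same expansion holds with the first sum (the polynomial with coefficients $\tau_i$) omitted, and $$p^+_{n,b}=\sum_{k=1}^{M_1-b-\chi}\frac{c_k}{\alpha_k^{n+1}}+\sum_{\nu=1}^m\sum_{i=1}^{\pi_\nu}\binom{\pi_\nu+n-i}{\pi_\nu-i}\frac{\zeta_{\nu,i}}{\beta_\nu^{\pi_\nu+n+1-i}},\quad n\ge0.$$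
   Context: The system is a discrete-time single-server queue with Bernoulli($\lambda$) arrivals, $0<\lambda<1$, and infinite waiting room. Customers are served in batches by the $(a,b)$ rule ($1\le a\le b$): service starts only if at least $a$ customers wait; all are taken if there are between $a$ and $b$, otherwise exactly $b$. The service time of a batch of size $r$ has a general distribution on $\{1,2,\dots\}$ depending on $r$, with pgf $S^*_r$ and mean $1/\mu_r$. After a service, if fewer than $a$ wait, the server takes a vacation of general distribution on $\{1,2,\dots\}$ with pgf $V^*$; if fewer than $a$ wait at the end of a vacation, the server either stays dormant until $a$ have accumulated (single vacation) or takes another vacation (multiple vacation). Stability $\lambda/(b\mu_b)<1$ is assumed. The numbers $p^+_{n,r}$ ($n\ge0$, $a\le r\le b$) are the steady-state probabilities that, at an epoch which is either a service completion or a vacation termination, a service of a batch of size $r$ is completed and $n$ customers are left in the queue. The denominator $D(x)$ arises from $x^b-K^{(b)}(x)$, with $K^{(b)}(x)=S^*_b(1-\lambda+\lambda x)$.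
   Formalization: The printed formula for ζ_{ν,i} is false for multiple zeros; it is corrected to ζ_{ν,i} = ((-1)^{i-1}/(i-1)!) lim_{x→β_ν} d^{i-1}/dx^{i-1}[(β_ν-x)^{π_ν}Λ(x)/D(x)], which matches the printed expansion. *)

(* Defs.v *)
From HB Require Import structures.
From mathcomp Require Import all_boot all_order all_algebra.
From mathcomp Require Import all_classical all_reals all_analysis.
From mathcomp.real_closed Require Import complex.

Set Implicit Arguments.
Unset Strict Implicit.
Unset Printing Implicit Defensive.

Import Order.TTheory GRing.Theory Num.Theory.
Import numFieldNormedType.Exports.

Local Open Scope classical_set_scope.
Local Open Scope ring_scope.

(* [R[i]] at type [numFieldType], so that limits, series and derivatives are
   taken for the topology of the complex modulus. *)
Definition cplx (R : realType) : numFieldType := R[i].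

Definition toC (R : realType) (x : R) : cplx R := real_complex R x.

(* Probability mass function of a duration with values in {1, 2, ...}. *)
Definition duration_law (R : realType) (f : nat -> R) : Prop :=
  [/\ f 0%N = 0, (forall k, 0 <= f k) & series f @ \oo --> (1 : R)].

Inductive vacation_rule := SingleVacation | MultipleVacation.

(* Batch-service queue with Bernoulli arrivals and vacations.  [service r] is
   the law of the service time of a batch of size [r]; [service] and
   [service_rate] are only relevant at sizes between [qa] and [qb]. *)
Record bulk_queue (R : realType) := BulkQueue {
  arrival_prob : R;
  qa : nat;
  qb : nat;
  service : nat -> nat -> R;
  service_rate : nat -> R;
  vacation : nat -> R;
  rule : vacation_rule;
  arrival_prob_itv : 0 < arrival_prob < 1;
  batch_bounds : (1 <= qa <= qb)%N;
  service_law : forall r, (qa <= r <= qb)%N -> duration_law (service r);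
  service_rate_gt0 : forall r, (qa <= r <= qb)%N -> 0 < service_rate r;
  service_mean : forall r, (qa <= r <= qb)%N ->
    series (fun k : nat => k%:R * service r k) @ \oo --> (service_rate r)^-1;
  vacation_law : duration_law vacation;
  stability : arrival_prob / (qb%:R * service_rate qb) < 1 }.

(* What is observed at an epoch that is either a service completion or a
   vacation termination: [(n, Some r)] when a batch of size [r] has just been
   served and [n] customers are left in the queue, [(n, None)] when a vacation
   has just ended with [n] customers in the queue. *)
Definition epoch : Type := (nat * option nat)%type.

(* What the server undertakes next: [(m, Some r)] is the service of a batch of
   size [r], started with [m] customers left waiting; [(m, None)] is a vacation
   started with [m] customers waiting.  After a single vacation ending with
   fewer than [qa] customers the server is dormant until there are exactly [qa]
   (arrivals come one at a time), and then serves all of them. *)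
Definition next_activity (R : realType) (Q : bulk_queue R) (e : epoch) :
    nat * option nat :=
  let: (n, k) := e in
  if (qa Q <= n)%N then ((n - minn n (qb Q))%N, Some (minn n (qb Q)))
  else match k, rule Q with
       | None, SingleVacation => (0%N, Some (qa Q))
       | _, _ => (n, None)
       end.

(* Probability of exactly [j] arrivals during a time of law [f]. *)
Definition arrivals (R : realType) (Q : bulk_queue R) (f : nat -> R) (j : nat)
    : R :=
  limn (series (fun k => f k * binomial_pmf k (arrival_prob Q) j)).

Definition transition (R : realType) (Q : bulk_queue R) (e e' : epoch) : R :=
  let: (m, k) := next_activity Q e in
  if (e'.2 == k) && (m <= e'.1)%N then
    arrivals Q (if k is Some r then service Q r else vacation Q) (e'.1 - m)
  else 0.

(* Stationary law of the Markov chain embedded at these epochs; it has total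
   mass 1 over service completions and vacation terminations together. *)
Definition steady_state (R : realType) (Q : bulk_queue R) (P : epoch -> R)
    : Prop :=
  [/\ (forall e, 0 <= P e),
      (\esum_(e in [set: epoch]) (P e)%:E = 1)%E &
      (forall e', \esum_(e in [set: epoch]) (P e * transition Q e e')%:E
                  = (P e')%:E)%E].

Definition polar_part (R : realType) (K m : nat) (alpha : 'I_K -> cplx R)
    (beta : 'I_m -> cplx R) (mult : 'I_m -> nat)
    (c : 'I_K -> cplx R) (zeta : 'I_m -> nat -> cplx R) (x : cplx R) : cplx R :=
  \sum_(k < K) c k / (alpha k - x) +
  \sum_(nu < m) \sum_(1 <= i < (mult nu).+1)
     zeta nu i / (beta nu - x) ^+ (mult nu - i + 1).

(* Coefficient of [x ^ n] in the power series of [polar_part] at [0]. *)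
Definition polar_coef (R : realType) (K m : nat) (alpha : 'I_K -> cplx R)
    (beta : 'I_m -> cplx R) (mult : 'I_m -> nat)
    (c : 'I_K -> cplx R) (zeta : 'I_m -> nat -> cplx R) (n : nat) : cplx R :=
  \sum_(k < K) c k / alpha k ^+ n.+1 +
  \sum_(nu < m) \sum_(1 <= i < (mult nu).+1)
     ('C(mult nu + n - i, mult nu - i))%:R *
     (zeta nu i / beta nu ^+ (mult nu + n + 1 - i)).

Definition simple_coefs (R : realType) (K : nat) (alpha : 'I_K -> cplx R)
    (Lambda D : {poly cplx R}) (c : 'I_K -> cplx R) : Prop :=
  forall k, c k = - (Lambda.[alpha k] / (deriv D).[alpha k]).

(* [zeta nu i] multiplies [(beta nu - x) ^ (i - 1 - mult nu)], so it is the
   coefficient of [(beta nu - x) ^ (i - 1)] in the Taylor expansion of [g] at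
   [beta nu]: the derivative has order [i - 1], and the sign comes from
   expanding in powers of [beta nu - x] rather than [x - beta nu]. *)
Definition multiple_coefs (R : realType) (m : nat) (beta : 'I_m -> cplx R)
    (mult : 'I_m -> nat) (Lambda D : {poly cplx R})
    (zeta : 'I_m -> nat -> cplx R) : Prop :=
  forall nu i, (1 <= i <= mult nu)%N ->
    let g x := (beta nu - x) ^+ mult nu * Lambda.[x] / D.[x] in
    cvg (derive1n (i - 1) g x @[x --> (beta nu)^']) /\
    zeta nu i = (-1) ^+ (i - 1) / ((i - 1)`!)%:R *
                lim (derive1n (i - 1) g x @[x --> (beta nu)^']).

(* [p] has generating function [F] on the closed unit disk minus [E]. *)
Definition has_gf (R : realType) (p : nat -> R) (E : set (cplx R))
    (F : cplx R -> cplx R) : Prop :=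
  forall x, `|x| <= 1 -> ~ E x ->
    series (fun n => toC (p n) * x ^+ n) @ \oo --> F x.

(* Main.v *)
Require Import Defs.
From mathcomp Require Import all_boot all_order all_algebra.
From mathcomp Require Import all_classical all_reals all_analysis.
From mathcomp.real_closed Require Import complex.
From mathcomp Require Import ring.

(* The zeros of [D] in the closed disk, simple and shared with [Lambda], contribute
   nothing to the partial fraction decomposition of [Lambda / D], which the Chinese
   remainder theorem provides.  What remains is a polynomial plus poles of modulus
   larger than 1, whose power series converge on the closed disk.  A power series
   is determined by its values at the points [1 / (n + 1)] that are not zeros of
   [D], so its coefficients are the probabilities. *)

Set Implicit Arguments.
Unset Strict Implicit.
Unset Printing Implicit Defensive.

Import Order.TTheory GRing.Theory Num.Theory.
Import numFieldNormedType.Exports.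

Local Open Scope classical_set_scope.
Local Open Scope ring_scope.

(** * Partial fractions *)

(** Linear factors are written [a - X], so that numerators expand in powers of [beta - x] as in
    [polar_part]; the signs in [simple_coefs] and [multiple_coefs] come from this choice. The power
    series are handled over a [numFieldType], where the norm takes values in the field itself and
    the field need not be archimedean. Their convergence to a pole term therefore rests on explicit
    inequalities for partial sums and on one hypothesis, that [1 / (n + 1)] tends to [0]. Since
    [Lambda.[x] / D.[x]] carries no information at a zero of [D], where division returns a default
    value, the quotient is only ever evaluated off the zeros, and the derivatives giving [zeta] are
    limits over punctured neighbourhoods. *)

Section PartialFractions.
Context (F : fieldType) (I : finType) (gamma : I -> F) (mu : I -> nat).
Context (D : {poly F}) (N : I -> {poly F}).
Hypothesis D_neq0 : D != 0.
Hypothesis DE : forall i, D = ((gamma i)%:P - 'X) ^+ mu i * N i.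
Hypothesis N_gamma : forall i, ~~ root (N i) (gamma i).
Hypothesis gamma_inj : injective gamma.

Local Notation pole i := (((gamma i)%:P - 'X) ^+ mu i).

Lemma size_pole i : size (pole i) = (mu i).+1.
Proof. by rewrite -opprB exprNn -signr_odd size_Msign size_exp_XsubC. Qed.

Lemma coprimep_subCX a (q : {poly F}) : coprimep (a%:P - 'X) q = ~~ root q a.
Proof. by rewrite -opprB -scaleN1r coprimepZl ?oppr_eq0 ?oner_eq0 //
  coprimep_sym coprimep_XsubC. Qed.

Lemma coprimep_pole i : coprimep (pole i) (N i).
Proof. by rewrite coprimep_expl // coprimep_subCX. Qed.

Lemma pole_dvd_cofactor i j : i != j -> pole i %| N j.
Proof.
move=> ij; have: pole i %| pole j * N j by rewrite -DE (DE i) dvdp_mulr.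
rewrite Gauss_dvdpr // coprimep_expl // coprimep_expr // coprimep_subCX.
by rewrite rootE !hornerE subr_eq0 (inj_eq gamma_inj) eq_sym.
Qed.

(** Modulo [pole i] every cofactor but [N i] is zero. Both existence and uniqueness of the
    decomposition rest on this congruence. *)
Lemma pole_dvd_sum (A : I -> {poly F}) i :
  pole i %| \sum_j A j * N j - A i * N i.
Proof.
rewrite (bigD1 i) //= addrAC subrr add0r.
elim/big_rec: _ => [|j q ji dq]; first exact: dvdp0.
by rewrite dvdp_add // dvdp_mull // pole_dvd_cofactor // eq_sym.
Qed.

(** Uniqueness, in linear form: [pole i] divides [A i * N i] and is coprime to [N i], so it divides
    [A i], which is too small to be a nonzero multiple. *)
Lemma partial_fractions_eq0 (T : {poly F}) (A : I -> {poly F}) :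
  (forall i, size (A i) <= mu i)%N ->
  T * D + \sum_i A i * N i = 0 -> T = 0 /\ forall i, A i = 0.
Proof.
move=> sA eq0.
have A0 i : A i = 0.
  apply/eqP/negP => /negP Ai_neq0.
  have: pole i %| A i * N i.
    rewrite -[A i * _](subKr (\sum_j A j * N j)) dvdp_sub ?pole_dvd_sum //.
    move/eqP: eq0; rewrite addrC addr_eq0 => /eqP ->.
    by rewrite dvdpNr (DE i) mulrCA dvdp_mulr.
  rewrite Gauss_dvdpl ?coprimep_pole // => /(dvdp_leq Ai_neq0).
  by rewrite size_pole ltnNge sA.
split=> //; move: eq0; rewrite big1 ?addr0; last by move=> i _; rewrite A0 mul0r.
by move/eqP; rewrite mulf_eq0 (negbTE D_neq0) orbF => /eqP.
Qed.

Hypothesis pole_dvd : forall q, (forall i, pole i %| q) -> D %| q.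

(** [A i] is the residue of [L / N i] modulo [pole i]. The difference between [L] and the sum is
    then divisible by each [pole i], and [pole_dvd], which says that these factors exhaust [D],
    makes it divisible by [D]. *)
Lemma partial_fractions (L : {poly F}) :
  exists2 A : I -> {poly F}, (forall i, size (A i) <= mu i)%N &
    L = L %/ D * D + \sum_i A i * N i.
Proof.
have inv i : exists u, pole i %| u * N i - 1.
  have /Bezout_eq1_coprimepP[[v u] /= <-] := coprimep_pole i.
  by exists u; rewrite opprD addrCA subrr addr0 dvdpNr dvdp_mull.
pose u i := xchoose (inv i).
pose A i := (L * u i) %% pole i.
have sA i : (size (A i) <= mu i)%N.
  by rewrite -ltnS -(size_pole i) ltn_modp -size_poly_eq0 size_pole.
exists A => //.
have: D %| L - \sum_i A i * N i.
  apply: pole_dvd => i.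
  rewrite -[L](subrK (A i * N i)) -addrA dvdp_addl; last first.
    by rewrite -dvdpNr opprB pole_dvd_sum.
  have -> : L - A i * N i = (L * u i) %/ pole i * pole i * N i
                            - L * (u i * N i - 1).
    have -> : A i = L * u i - (L * u i) %/ pole i * pole i.
      by rewrite /A; move: (divp_eq (L * u i) (pole i)) => /eqP;
        rewrite addrC -subr_eq => /eqP <-.
    by ring.
  apply: dvdp_sub; first by rewrite mulrAC dvdp_mull.
  by rewrite dvdp_mull // (xchooseP (inv i)).
case/dvdpP => T /eqP; rewrite subr_eq => /eqP LE.
(* [D] has size [mu i + size (N i)], so [size (A i) <= mu i] makes each term of the sum smaller than
   [D]: [T] is the Euclidean quotient. *)
suff -> : L %/ D = T by [].
rewrite {1}LE divp_addl_mul_small //.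
apply: leq_ltn_trans (size_sum _ _ _) _.
have D_gt0 : (0 < size D)%N by rewrite size_poly_gt0.
rewrite -(prednK D_gt0) ltnS; apply/bigmax_leqP => i _.
rewrite -ltnS (prednK D_gt0).
have [->|Ai_neq0] := eqVneq (A i) 0; first by rewrite mul0r size_poly0.
have Ni_neq0 : N i != 0.
  by apply: contraNneq (N_gamma i) => ->; rewrite root0.
rewrite (DE i) size_mul // size_mul -?size_poly_eq0 ?size_pole ?size_poly_eq0 //.
rewrite addSn /= (leq_trans _ (leq_add (sA i) (leqnn _))) //.
by rewrite prednK // addn_gt0 size_poly_gt0 Ai_neq0.
Qed.

End PartialFractions.

Lemma horner_taylor (F : comNzRingType) (A : {poly F}) n a x :
  (size A <= n)%N ->
  A.[x] = \sum_(j < n) ((-1) ^+ j * A^`N(j).[a]) * (a - x) ^+ j.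
Proof.
move=> sA; have := nderiv_taylor_wide (mulrC a (x - a)) sA.
rewrite addrC subrK => ->; apply: eq_bigr => j _.
by rewrite -[a - x]opprB (exprNn (x - a)) mulrACA -exprMn mulrN1 opprK expr1n mul1r.
Qed.

(** Both polynomials split; comparing multiplicities makes the roots of [p] a sub-multiset of those
    of [q], and the roots left over form the cofactor. *)
Lemma dvdp_mup (F : closedFieldType) (p q : {poly F}) :
  p != 0 -> (forall x, ('X - x%:P) ^+ mup x p %| q) -> p %| q.
Proof.
move=> p_neq0 pq; have [->|q_neq0] := eqVneq q 0; first exact: dvdp0.
have [[rs pE] [ss qE]] := (closed_field_poly_normal p, closed_field_poly_normal q).
have mup_lead (r : {poly F}) rs' x : r != 0 ->
    r = lead_coef r *: \prod_(z <- rs') ('X - z%:P) ->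
    mup x r = count_mem x rs'.
  move=> r_neq0 {1}->; rewrite -mul_polyC mupMr ?mu_prod_XsubC //.
  by rewrite rootC lead_coef_eq0.
have /count_subseqP[s sub_s perm_s] :
    forall x, (count_mem x rs <= count_mem x ss)%N.
  by move=> x; rewrite -(mup_lead p) // -(mup_lead q) // mup_geq.
have [t perm_t] := perm_to_subseq sub_s.
rewrite pE qE dvdpZl ?lead_coef_eq0 // dvdpZr ?lead_coef_eq0 //.
by rewrite (perm_big _ perm_s) (perm_big _ perm_t) big_cat dvdp_mulr.
Qed.

(** * Derivatives of rational functions *)

Section RationalDerivatives.
Context (K : numFieldType).
Implicit Types (p q v : {poly K}) (x y : K).

Lemma is_derive_horner p x : is_derive x (1 : K) (horner p) p^`().[x].
Proof.
elim/poly_ind: p => [|p c IHp].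
  have -> : horner (0 : {poly K}) = cst 0 by apply/funext => y; rewrite horner0.
  by rewrite deriv0 horner0; exact: is_derive_cst.
have -> : horner (p * 'X + c%:P) = (horner p * id + cst c)%R.
  by apply/funext => y; rewrite !hornerE.
apply: is_derive_eq.
by rewrite derivD derivM derivX derivC !hornerE /GRing.scale /= addrC mulrC mulr1.
Qed.

Lemma horner_continuous p : continuous (horner p).
Proof.
move=> x; apply/differentiable_continuous/derivable1_diffP.
by have [] := is_derive_horner p x.
Qed.

Lemma near_horner_neq0 v x : v.[x] != 0 -> \forall y \near x, v.[y] != 0.
Proof. by move=> vx; exact: (cvgr_neq0 _ (@horner_continuous v x) vx). Qed.

Lemma is_derive_rational (A B v : {poly K}) x : v.[x] != 0 ->
  is_derive x (1 : K) (fun y => A.[y] + B.[y] / v.[y])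
    (A^`().[x] + (B^`() * v - B * v^`()).[x] / (v ^+ 2).[x]).
Proof.
move=> vx.
have dA := is_derive_horner A x; have dB := is_derive_horner B x.
have dv := is_derive_horner v x.
have dV : is_derive x (1 : K) (fun y => (v.[y])^-1) (- v.[x] ^- 2 * v^`().[x]).
  apply: DeriveDef; first by apply: derivableV => //; case: dv.
  by rewrite deriveV //; case: dv => // _ ->.
have dBV := is_deriveM dB dV; have dABV := is_deriveD dA dBV.
apply: is_derive_eq dABV _; congr (_ + _).
rewrite hornerD hornerN !hornerM ?horner_exp -![_ *: _]/(_ * _).
by field.
Qed.

(** The right-hand side is the numerator in the quotient rule: a derivation lowers the order of
    vanishing by at most one. *)
Lemma dvdp_quotient_deriv (B v : {poly K}) b n :
  ('X - b%:P) ^+ n.+1 %| B -> ('X - b%:P) ^+ n %| B^`() * v - B * v^`().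
Proof.
move=> /dvdpP[C ->]; apply: dvdp_sub; apply: dvdp_mulr; last first.
  by rewrite exprS mulrA dvdp_mull.
rewrite derivM deriv_exp /= dvdp_add //; last first.
  by rewrite dvdp_mull // -mulr_natr dvdp_mulr // dvdp_mull.
by rewrite exprS mulrA dvdp_mull.
Qed.

Section DerivativesOffPole.
Context (A B N D : {poly K}) (f : K -> K) (b : K) (n : nat).
Hypothesis N_neq0 : forall x, D.[x] != 0 -> N.[x] != 0.
Hypothesis B_dvd : ('X - b%:P) ^+ n %| B.
Hypothesis fE : forall x, D.[x] != 0 -> f x = A.[x] + B.[x] / N.[x].

(** The shape polynomial plus fraction over a power of [N] is stable under derivation, each
    derivation costing one order of vanishing at [b]. *)
Lemma derive1n_rational k : (k <= n)%N ->
  exists Bk e, ('X - b%:P) ^+ (n - k) %| Bk /\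
    forall x, D.[x] != 0 ->
      derive1n k f x = A^`(k).[x] + Bk.[x] / (N ^+ e).[x].
Proof.
elim: k => [|k IHk] kn; first by exists B, 1%N; rewrite subn0 expr1.
have [Bk [e [Bk_dvd fkE]]] := IHk (ltnW kn).
exists (Bk^`() * N ^+ e - Bk * (N ^+ e)^`()), (e * 2)%N; split.
  by apply: dvdp_quotient_deriv; rewrite subnSK.
move=> x Dx; rewrite derive1nS derive1E derivnS exprM.
have Nx : (N ^+ e).[x] != 0 by rewrite horner_exp expf_neq0 // N_neq0.
have [_ <-] := is_derive_rational A^`(k) Bk Nx.
(* Being off the zeros of [D] is an open condition, so the formula for the [k]-th derivative holds
   around [x] and may be differentiated. *)
apply: near_eq_derive; near=> y; apply: fkE; near: y.
exact: near_horner_neq0.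
Unshelve. all: by end_near. Qed.

Hypothesis Nb : N.[b] != 0.
Hypothesis D_neq0 : \forall x \near b^', D.[x] != 0.

(** For [k < n] the fraction still vanishes at [b], so only the polynomial [A] is seen by the
    limit. *)
Lemma cvg_derive1n_rational k : (k < n)%N ->
  derive1n k f x @[x --> b^'] --> A^`(k).[b].
Proof.
move=> kn; have [Bk [e [Bk_dvd fkE]]] := derive1n_rational (ltnW kn).
have Bkb : Bk.[b] = 0.
  apply/rootP; rewrite -dvdp_XsubCl; apply: dvdp_trans Bk_dvd.
  by rewrite -subnSK // exprS dvdp_mulr.
have : A^`(k).[x] + Bk.[x] / (N ^+ e).[x] @[x --> b^'] --> A^`(k).[b].
  apply: cvg_within_filter.
  have -> : A^`(k).[b] = A^`(k).[b] + Bk.[b] / (N ^+ e).[b].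
    by rewrite Bkb mul0r addr0.
  apply: cvgD; first exact: horner_continuous.
  apply: cvgM; first exact: horner_continuous.
  apply: cvgV; last exact: horner_continuous.
  by rewrite horner_exp expf_neq0.
apply: cvg_trans; apply: near_eq_cvg; near=> x.
by rewrite fkE //; near: x.
Unshelve. all: by end_near. Qed.

End DerivativesOffPole.
End RationalDerivatives.

(** * Power series *)

Section SeriesOfPoles.
Context (K : numFieldType).
Implicit Types (x y b : K).

Lemma cvg_seriesD (u v : nat -> K) l k :
  series u @ \oo --> l -> series v @ \oo --> k ->
  series (fun n => u n + v n) @ \oo --> l + k.
Proof.
move=> ul vk; have -> : series (fun n => u n + v n) = series u \+ series v.
  by apply/funext => n; rewrite /series /= big_split.
exact: (cvgD ul vk).
Qed.

Lemma cvg_seriesZ (u : nat -> K) l k :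
  series u @ \oo --> l -> series (fun n => k * u n) @ \oo --> k * l.
Proof.
move=> ul; have -> : series (fun n => k * u n) = (fun n => k * series u n).
  by apply/funext => n; rewrite /series /= mulr_sumr.
exact: (cvgM (cvg_cst k) ul).
Qed.

Lemma cvg_series_sum (I : Type) (r : seq I) (P : pred I) (u : I -> nat -> K) l :
  (forall i, P i -> series (u i) @ \oo --> l i) ->
  series (fun n => \sum_(i <- r | P i) u i n) @ \oo --> \sum_(i <- r | P i) l i.
Proof.
move=> ul; elim: r => [|i r IHr].
  rewrite big_nil; under [X in series X]eq_fun do rewrite big_nil.
  have -> : series (fun=> 0 : K) = cst 0.
    by apply/funext => n; rewrite /series /= big1.
  exact: cvg_cst.
rewrite big_cons; under [X in series X]eq_fun do rewrite big_cons.
by case: ifP => // /ul uil; exact: cvg_seriesD.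
Qed.

Lemma cvg_series_poly (T : {poly K}) x :
  series (fun n => T`_n * x ^+ n) @ \oo --> T.[x].
Proof.
apply: cvg_near_cst; near=> n.
rewrite /series /= (@horner_coef_wide _ n) ?big_mkord //.
by near: n; exact: nbhs_infty_ge.
Unshelve. all: by end_near. Qed.

(** Summation by parts with Pascal's rule: the factor [1 - y] lowers [s] by one and leaves a
    boundary term. *)
Lemma sum_binomialX (A : comNzRingType) s N (y : A) :
  (\sum_(0 <= n < N) ('C(n + s.+1, s.+1))%:R * y ^+ n) * (1 - y) =
  \sum_(0 <= n < N) ('C(n + s, s))%:R * y ^+ n - ('C(N + s, s.+1))%:R * y ^+ N.
Proof.
elim: N => [|N IHN]; first by rewrite !big_geq // bin_small // !mul0r subr0.
rewrite !big_nat_recr //= mulrDl IHN addnS binS natrD exprS.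
by ring.
Qed.

Lemma sum_geometric (A : comNzRingType) N (y : A) :
  (\sum_(0 <= n < N) ('C(n + 0, 0))%:R * y ^+ n) * (1 - y) = 1 - y ^+ N.
Proof.
rewrite mulrC -opprB mulNr -(opprB (y ^+ N)) subrX1 big_mkord; congr (- (_ * _)).
by apply: eq_bigr => i _; rewrite bin0 mul1r.
Qed.

Lemma sum_binomialX_le s N (r : K) : 0 <= r < 1 ->
  (\sum_(0 <= n < N) ('C(n + s, s))%:R * r ^+ n) * (1 - r) ^+ s.+1 <= 1.
Proof.
case/andP=> r0 r1; have r1_ge0 : 0 <= 1 - r by rewrite subr_ge0 ltW.
elim: s => [|s IHs].
  by rewrite expr1 sum_geometric lerBlDr lerDl exprn_ge0.
rewrite exprS mulrA sum_binomialX; apply: le_trans IHs.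
by rewrite ler_wpM2r ?exprn_ge0 // lerBlDr lerDl mulr_ge0 ?exprn_ge0 ?ler0n.
Qed.

(** The extra factor [N + 1] gives decay as fast as the harmonic sequence. It is absorbed by
    [(N+s+1) C(N+s, s) = (s+1) C(N+s+1, s+1)], and the right side leads to one term of the
    nonnegative sum bounded by [sum_binomialX_le] at [s + 1]. *)
Lemma binomialX_le s N (r : K) : 0 <= r < 1 ->
  ('C(N + s, s))%:R * r ^+ N * N.+1%:R <= s.+1%:R / (1 - r) ^+ s.+2.
Proof.
move=> /[dup] r01 /andP[r0 r1].
have r1X : 0 < (1 - r) ^+ s.+2 by rewrite exprn_gt0 // subr_gt0.
apply: (@le_trans _ _ (s.+1%:R * (('C(N + s.+1, s.+1))%:R * r ^+ N))).
  rewrite mulrAC mulrA ler_wpM2r ?exprn_ge0 // -!natrM ler_nat.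
  by rewrite addnS -mul_bin_diag mulnC leq_mul2r ltnS leq_addr orbT.
rewrite ler_wpM2l ?ler0n // -[leRHS]mul1r ler_pdivlMr //.
apply: le_trans (sum_binomialX_le s.+1 N.+1 r01).
rewrite ler_wpM2r ?(ltW r1X) // big_nat_recr //= lerDr.
by apply: sumr_ge0 => i _; rewrite mulr_ge0 ?exprn_ge0 ?ler0n.
Qed.

Hypothesis harmonic_cvg0 : n.+1%:R^-1 @[n --> \oo] --> (0 : K).

Lemma cvg0_le_harmonic (u : nat -> K) M :
  (forall n, `|u n| * n.+1%:R <= M) -> u @ \oo --> (0 : K).
Proof.
move=> uM; have M_ge0 : 0 <= M by apply: le_trans (uM 0%N); rewrite mulr_ge0.
have Mh : M * n.+1%:R^-1 @[n --> \oo] --> (0 : K).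
  by rewrite -(mulr0 M); exact: (cvgM (cvg_cst M) harmonic_cvg0).
apply/cvgr0Pnorm_lt => e e0; near=> n.
have : `|M * n.+1%:R^-1| < e.
  by near: n; exact: (cvgr0_norm_lt _ Mh).
apply: le_lt_trans.
rewrite /= normrM normfV (ger0_norm M_ge0) normr_nat.
by rewrite ler_pdivlMr ?ltr0n.
Unshelve. all: by end_near. Qed.

Lemma cvg_binomialX s y : `|y| < 1 ->
  ('C(n + s, s))%:R * y ^+ n @[n --> \oo] --> (0 : K).
Proof.
move=> y1; apply: (@cvg0_le_harmonic _ (s.+1%:R / (1 - `|y|) ^+ s.+2)) => n.
by rewrite normrM normrX normr_nat binomialX_le // normr_ge0.
Qed.

Lemma cvg_series_binomialX s y : `|y| < 1 ->
  series (fun n => ('C(n + s, s))%:R * y ^+ n) @ \oo --> ((1 - y) ^+ s.+1)^-1.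
Proof.
move=> y1; have y_neq1 : 1 - y != 0.
  by rewrite subr_eq0; apply: contraTneq y1 => <-; rewrite normr1 ltxx.
elim: s => [|s IHs].
  have -> : series (fun n => ('C(n + 0, 0))%:R * y ^+ n) =
            (fun N => (1 - ('C(N + 0, 0))%:R * y ^+ N) / (1 - y)).
    apply/funext => N; rewrite /series /= bin0 mul1r -sum_geometric.
    by rewrite mulfK.
  suff : (1 - ('C(N + 0, 0))%:R * y ^+ N) / (1 - y) @[N --> \oo] -->
         (1 - 0) / (1 - y) by rewrite subr0 mul1r.
  apply: cvgM; last exact: cvg_cst.
  exact: (cvgB (cvg_cst (1 : K)) (@cvg_binomialX 0 y y1)).
have -> : series (fun n => ('C(n + s.+1, s.+1))%:R * y ^+ n) =
          (fun N => (series (fun n => ('C(n + s, s))%:R * y ^+ n) N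
                     - ('C(N + s, s.+1))%:R * y ^+ N) / (1 - y)).
  by apply/funext => N; rewrite /series /= -sum_binomialX mulfK.
have -> : ((1 - y) ^+ s.+2)^-1 = (((1 - y) ^+ s.+1)^-1 - 0) / (1 - y).
  by rewrite subr0 exprS invfM mulrC.
suff w0 : ('C(N + s, s.+1))%:R * y ^+ N @[N --> \oo] --> (0 : K).
  exact: (cvgM (cvgB IHs w0) (cvg_cst (1 - y)^-1)).
(* The boundary coefficient [C(n+s, s+1)] is at most [C(n+s+1, s+1)], to which [binomialX_le]
   applies. *)
apply: (@cvg0_le_harmonic _ (s.+2%:R / (1 - `|y|) ^+ s.+3)) => n.
apply: le_trans (binomialX_le s.+1 n _); last by rewrite normr_ge0.
rewrite normrM normrX normr_nat ler_wpM2r ?ler0n //.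
by rewrite ler_wpM2r ?exprn_ge0 // ler_nat addnS binS leq_addr.
Qed.

Lemma cvg_series_pole (s : nat) (w b x : K) : `|x| < `|b| ->
  series (fun n => ('C(s + n, s))%:R * (w / b ^+ (s + n).+1) * x ^+ n) @ \oo
    --> w / (b - x) ^+ s.+1.
Proof.
move=> xb; have b_neq0 : b != 0.
  by rewrite -normr_gt0; apply: le_lt_trans xb.
have y1 : `|x / b| < 1 by rewrite normrM normfV ltr_pdivrMr ?normr_gt0 ?mul1r.
have -> : (fun n => ('C(s + n, s))%:R * (w / b ^+ (s + n).+1) * x ^+ n) =
    (fun n => w / b ^+ s.+1 * (('C(n + s, s))%:R * (x / b) ^+ n)).
  apply/funext => n; rewrite -addSn exprD invfM exprMn exprVn (addnC n).
  by ring.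
have -> : w / (b - x) ^+ s.+1 = w / b ^+ s.+1 * ((1 - x / b) ^+ s.+1)^-1.
  by rewrite -mulrA -invfM -exprMn mulrBr mulr1 mulrCA divff ?mulr1.
exact/cvg_seriesZ/cvg_series_binomialX.
Qed.

End SeriesOfPoles.

Section ComplexHarmonic.
Context (R : realType).

(** The order on [R[i]] is partial and only compares numbers with equal imaginary parts; hence
    tolerances in complex limits are real. *)
Lemma cplx_posE (e : cplx R) : 0 < e -> exists2 r : R, 0 < r & e = toC r.
Proof.
case: e => a b /=; rewrite /Order.lt /= => /andP[/eqP b0 a0].
by exists a => //; rewrite b0.
Qed.

Lemma cplx_harmonic_cvg0 : n.+1%:R^-1 @[n --> \oo] --> (0 : cplx R).
Proof.
apply/cvgr0Pnorm_lt => e /cplx_posE[r r0 ->].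
have small : \forall n \near \oo, `|harmonic n : R| < r.
  exact: (cvgr0_norm_lt _ cvg_harmonic).
near=> n; have : `|harmonic n : R| < r by near: n.
rewrite /= !ger0_norm ?invr_ge0 ?ler0n //.
by rewrite /toC -(rmorph_nat (real_complex R)) -fmorphV ltcR.
Unshelve. all: by end_near. Qed.

End ComplexHarmonic.

Section IdentityTheorem.
Context (K : numFieldType).
Hypothesis harmonic_cvg0 : n.+1%:R^-1 @[n --> \oo] --> (0 : K).

(** Among [size D] distinct points one is not a root; the cutoff [k] allows points arbitrarily close
    to [0]. *)
Lemma harmonic_nonroot (D : {poly K}) k : D != 0 ->
  exists2 n, (k <= n)%N & D.[n.+1%:R^-1] != 0.
Proof.
move=> D_neq0; apply: contrapT => no_n.
suff: (size [seq n.+1%:R^-1 : K | n <- iota k (size D)] < size D)%N.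
  by rewrite size_map size_iota ltnn.
apply: max_poly_roots => //.
  apply/allP => y /mapP[n]; rewrite mem_iota => /andP[kn _] ->.
  by apply/negPn/negP => Dn; apply: no_n; exists n.
rewrite map_inj_uniq ?iota_uniq // => i j /invr_inj /eqP.
by rewrite eqr_nat eqSS => /eqP.
Qed.

Lemma poly_eq0_harmonic (D p : {poly K}) : D != 0 ->
  (forall n, D.[n.+1%:R^-1] != 0 -> p.[n.+1%:R^-1] = 0) -> p = 0.
Proof.
move=> D_neq0 p0; apply: contrapT => /eqP p_neq0.
have [n _] := @harmonic_nonroot (D * p) 0 (mulf_neq0 D_neq0 p_neq0).
by rewrite hornerM; have [->|/p0->] := eqVneq D.[n.+1%:R^-1] 0;
  rewrite ?mul0r ?mulr0 eqxx.
Qed.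

(** The first possibly nonzero term is isolated from a tail dominated by a geometric series of ratio
    [x / r <= 1/2], whose sum is at most [2]. The bound concerns partial sums, so no limit of the
    tail is needed. *)
Lemma power_series_tail_le (d : nat -> K) (M r x : K) N m : 0 < r -> 0 <= M ->
  (forall k, `|d k| * r ^+ k <= M) -> 0 < x -> x <= r / 2%:R ->
  (forall k, (k < N)%N -> d k = 0) ->
  `|d N| * x ^+ N <=
    `|\sum_(0 <= k < N.+1 + m) d k * x ^+ k| + 2%:R * M * (x / r) ^+ N.+1.
Proof.
move=> r0 M0 dM x0 xr d0; set q := x / r.
have q0 : 0 <= q by rewrite divr_ge0 // ltW.
have qle : q <= 2%:R^-1 by rewrite ler_pdivrMr // mulrC.
have q1 : q < 1 by apply: le_lt_trans qle _; rewrite invf_lt1 ?ltr0n ?ltr1n.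
rewrite (big_cat_nat _ (n := N.+1)) ?leq_addr //= big_nat_recr //=.
rewrite big_nat big1 ?add0r; last by move=> k /andP[_ kN]; rewrite d0 ?mul0r.
set tail := \sum_(N.+1 <= _ < _) _.
have -> : `|d N| * x ^+ N = `|d N * x ^+ N| by rewrite normrM normrX (gtr0_norm x0).
rewrite -{1}[d N * _](addrK tail); apply: le_trans (ler_normB _ _) _.
rewrite lerD2l.
apply: (@le_trans _ _ (M * q ^+ N.+1 * \sum_(0 <= k < m) q ^+ k)).
  rewrite /tail -{1}[N.+1]add0n big_addn addKn mulr_sumr.
  apply: le_trans (ler_norm_sum _ _ _) _; apply: ler_sum => k _.
  rewrite normrM normrX (gtr0_norm x0) -mulrA -exprD addnC /q expr_div_n mulrA.
  by rewrite ler_pdivlMr ?exprn_gt0 // mulrAC ler_pM2r ?exprn_gt0.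
rewrite mulrC -[leRHS]mulrA ler_wpM2r //.
  by rewrite mulr_ge0 ?exprn_ge0.
have := @sum_binomialX_le K 0 m q; rewrite q0 q1 expr1 => /(_ isT).
rewrite (eq_bigr (fun k => q ^+ k)); last by move=> k _; rewrite bin0 mul1r.
move=> Sq; have S0 : 0 <= \sum_(0 <= k < m) q ^+ k.
  by apply: sumr_ge0 => k _; rewrite exprn_ge0.
have h : 2%:R^-1 <= 1 - q.
  rewrite lerBrDr; apply: le_trans (_ : _ <= 2%:R^-1 + 2%:R^-1) _.
    by rewrite lerD2l.
  by rewrite -mulr2n -(mulr_natr 2%:R^-1 2) mulVf ?pnatr_eq0.
have := le_trans (ler_wpM2l S0 h) Sq.
by rewrite ler_pdivrMr ?ltr0n // mul1r.
Qed.

Lemma power_series_eq0 (d : nat -> K) (D : {poly K}) : D != 0 ->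
  (forall n, D.[n.+1%:R^-1] != 0 ->
     series (fun k => d k * n.+1%:R^-1 ^+ k) @ \oo --> (0 : K)) ->
  forall k, d k = 0.
Proof.
move=> D_neq0 d_cvg0.
(* Convergence at a single point [r] bounds all [d k * r ^ k], which controls the tails at smaller
   points. *)
have [n0 _ /d_cvg0 d_n0] := harmonic_nonroot 0 D_neq0.
set r : K := n0.+1%:R^-1 in d_n0; have r0 : 0 < r by rewrite invr_gt0 ltr0n.
have [M M0 dM] : exists2 M, 0 < M & forall k, `|d k| * r ^+ k <= M.
  have /cvg_series_cvg_0 d0 : cvgn (series (fun k => d k * r ^+ k)).
    by apply/cvg_ex; exists 0.
  have /pinfty_ex_gt0[M M0 dM] := cvg_seq_bounded (cvgP _ d0).
  exists M => // k; have := dM k I.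
  by rewrite /= normrM normrX (gtr0_norm r0).
elim/ltn_ind => N IHN; apply: contrapT => /eqP dN.
(* With [q = x / r], the tail costs [2 M q^(N+1)], and a partial sum close enough to its limit [0]
   costs one more [M q^(N+1)]. Dividing by [x^N] leaves [|d N| <= B x], which fails for small
   [x]. *)
pose B := 3%:R * M * r^-1 ^+ N.+1.
have B_gt0 : 0 < B by rewrite !mulr_gt0 ?exprn_gt0 ?invr_gt0.
have [k0 _ small] : \forall n \near \oo,
    `|n.+1%:R^-1 : K| < r / 2%:R /\ `|n.+1%:R^-1 : K| < `|d N| / B.
  near=> n; split; near: n; apply: (cvgr0_norm_lt _ harmonic_cvg0).
    by rewrite divr_gt0 ?ltr0n.
  by rewrite divr_gt0 ?normr_gt0.
have [n k0n Dn] := harmonic_nonroot k0 D_neq0.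
have [] := small n k0n; set x : K := n.+1%:R^-1.
have x0 : 0 < x by rewrite invr_gt0 ltr0n.
rewrite gtr0_norm // => xr xB.
suff: `|d N| / B <= x by move/(lt_le_trans xB); rewrite ltxx.
rewrite ler_pdivrMr // -(ler_pM2r (exprn_gt0 N x0)).
have q0 : 0 < M * (x / r) ^+ N.+1 by rewrite mulr_gt0 ?exprn_gt0 ?divr_gt0.
have [m0 _ tail_small] := cvgr0_norm_lt _ (d_cvg0 n Dn) _ q0.
apply: le_trans (power_series_tail_le m0 r0 (ltW M0) dM x0 (ltW xr) IHN) _.
have {tail_small} := tail_small (N.+1 + m0)%N (leq_addl _ _).
rewrite /series /= => /ltW tail_le.
apply: le_trans (lerD tail_le (lexx _)) _.
rewrite le_eqVlt; apply/orP; left; apply/eqP.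
by rewrite /B expr_div_n exprVn (exprS x); ring.
Unshelve. all: by end_near. Qed.

Lemma power_series_uniq (u v : nat -> K) (F : K -> K) (D : {poly K}) : D != 0 ->
  (forall n, let x := n.+1%:R^-1 in D.[x] != 0 ->
     series (fun k => u k * x ^+ k) @ \oo --> F x /\
     series (fun k => v k * x ^+ k) @ \oo --> F x) ->
  forall k, u k = v k.
Proof.
move=> D_neq0 uv k; apply/eqP; rewrite -subr_eq0; apply/eqP; move: k.
apply: (power_series_eq0 D_neq0) => n Dx; set x : K := _^-1.
have [ux vx] := uv n Dx.
have := cvg_seriesD ux (cvg_seriesZ (k := -1) vx).
rewrite mulN1r subrr.
suff -> : (fun k => u k * x ^+ k + -1 * (v k * x ^+ k)) =
          (fun k => (u k - v k) * x ^+ k) by [].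
by apply/funext => k; rewrite mulN1r -mulNr -mulrDl.
Qed.

End IdentityTheorem.

(** * Poles of the generating function *)

Section QueuePartialFractions.
Context (R : realType).
Local Notation C := (cplx R).
Context (b K m : nat) (D : {poly C}).
Context (z : 'I_b -> C) (alpha : 'I_K -> C) (beta : 'I_m -> C).
Context (mult : 'I_m -> nat).
Hypothesis D_neq0 : D != 0.
Hypothesis z_inj : injective z.
Hypothesis alpha_inj : injective alpha.
Hypothesis beta_inj : injective beta.
Hypothesis root_in : forall x, root D x /\ `|x| <= 1 <-> exists j, x = z j.
Hypothesis root_out : forall x, root D x /\ 1 < `|x| <->
  (exists k, x = alpha k) \/ (exists nu, x = beta nu).
Hypothesis mup_z : forall j, mup (z j) D = 1%N.
Hypothesis mup_alpha : forall k, mup (alpha k) D = 1%N.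
Hypothesis mup_beta : forall nu, (1 < mult nu)%N /\ mup (beta nu) D = mult nu.

Local Notation index := ('I_b + ('I_K + 'I_m))%type.

Definition pole (i : index) : C :=
  match i with
  | inl j => z j
  | inr (inl k) => alpha k
  | inr (inr nu) => beta nu
  end.

Definition pole_mult (i : index) : nat :=
  if i is inr (inr nu) then mult nu else 1%N.

Definition cofactor_poly (i : index) : {poly C} :=
  D %/ ((pole i)%:P - 'X) ^+ pole_mult i.

Local Notation N := cofactor_poly.

Lemma alpha_gt1 k : 1 < `|alpha k|.
Proof. by have [_] : root D (alpha k) /\ 1 < `|alpha k|
  by apply/root_out; left; exists k. Qed.

Lemma beta_gt1 nu : 1 < `|beta nu|.
Proof. by have [_] : root D (beta nu) /\ 1 < `|beta nu|
  by apply/root_out; right; exists nu. Qed.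

Lemma z_le1 j : `|z j| <= 1.
Proof. by have [_] : root D (z j) /\ `|z j| <= 1 by apply/root_in; exists j. Qed.

Lemma mup_pole i : mup (pole i) D = pole_mult i.
Proof. by case: i => [j|[k|nu]] /=; [|exact: mup_alpha|case: (mup_beta nu)]. Qed.

Lemma pole_mult_gt0 i : (0 < pole_mult i)%N.
Proof. by case: i => [j|[k|nu]] //=; case: (mup_beta nu) => /ltnW. Qed.

(** The modulus separates the [z] from the other two families, and the multiplicity, [1] against at
    least [2], separates [alpha] from [beta]. *)
Lemma pole_inj : injective pole.
Proof.
have in_out j x : 1 < `|x| -> z j = x -> False.
  by move=> x1 zx; have := z_le1 j; rewrite zx => /(lt_le_trans x1); rewrite ltxx.
have simple_mult k nu : alpha k = beta nu -> False.
  move=> ab; have [m1 mb] := mup_beta nu.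
  by have := mup_alpha k; rewrite ab mb => m1E; rewrite m1E in m1.
case=> [j|[k|nu]] [j'|[k'|nu']] //= e.
- by rewrite (z_inj e).
- by case: (in_out _ _ (alpha_gt1 k') e).
- by case: (in_out _ _ (beta_gt1 nu') e).
- by case: (in_out _ _ (alpha_gt1 k) (esym e)).
- by rewrite (alpha_inj e).
- by case: (simple_mult _ _ e).
- by case: (in_out _ _ (beta_gt1 nu) (esym e)).
- by case: (simple_mult _ _ (esym e)).
- by rewrite (beta_inj e).
Qed.

Lemma pole_dvdE (a : C) n q :
  ((a%:P - 'X) ^+ n %| q) = (('X - a%:P) ^+ n %| q).
Proof.
by rewrite -opprB -scaleN1r exprZn dvdpZl // expf_neq0 // oppr_eq0 oner_eq0.
Qed.

Lemma cofactorE i : D = ((pole i)%:P - 'X) ^+ pole_mult i * N i.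
Proof. by rewrite mulrC divpK // pole_dvdE -mup_geq // mup_pole. Qed.

Lemma cofactor_pole i : ~~ root (N i) (pole i).
Proof.
apply/negP; rewrite -dvdp_XsubCl => N_dvd.
have: ('X - (pole i)%:P) ^+ (pole_mult i).+1 %| D.
  by rewrite (cofactorE i) exprSr dvdp_mul // -pole_dvdE.
by rewrite -mup_geq // mup_pole ltnn.
Qed.

(** The type [cplx R] only shows a [numFieldType]; algebraic closedness is recovered by conversion
    to [R[i]]. *)
Lemma cplx_dvdp_mup (p q : {poly C}) :
  p != 0 -> (forall x, ('X - x%:P) ^+ mup x p %| q) -> p %| q.
Proof. exact: (@dvdp_mup R[i]). Qed.

Lemma poles_dvd q :
  (forall i, ((pole i)%:P - 'X) ^+ pole_mult i %| q) -> D %| q.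
Proof.
move=> pole_dvd; apply: cplx_dvdp_mup => // x.
have [Dx|Dx] := boolP (root D x); last by rewrite mupNroot // dvd1p.
suff [i ->] : exists i, x = pole i by rewrite mup_pole -pole_dvdE.
have [x1|x1] := boolP (`|x| <= 1).
  by have [/(_ (conj Dx x1))[j ->] _] := root_in x; exists (inl j).
(* The order is partial; the dichotomy holds because a modulus is real. *)
have {}x1 : 1 < `|x| by rewrite real_ltNge ?real1 ?normr_real.
by have [/(_ (conj Dx x1))[[k ->]|[nu ->]] _] := root_out x;
  [exists (inr (inl k)) | exists (inr (inr nu))].
Qed.

Lemma pole_neq i x : D.[x] != 0 -> pole i - x != 0.
Proof.
rewrite (cofactorE i) hornerM horner_exp !hornerE mulf_eq0 negb_or.
by case/andP; rewrite expf_eq0 pole_mult_gt0.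
Qed.

(* The numerator at each pole is expanded in powers of the linear factor, so that
   its coefficients are those of [polar_part]; a pole in the closed unit disk
   contributes nothing. *)
Definition numerator (c : 'I_K -> C) (zeta : 'I_m -> nat -> C) (i : index)
    : {poly C} :=
  match i with
  | inl _ => 0
  | inr (inl k) => (c k)%:P
  | inr (inr nu) =>
      (\poly_(j < mult nu) zeta nu j.+1) \Po ((beta nu)%:P - 'X)
  end.

Lemma size_subCX (a : C) : size (a%:P - 'X) = 2%N.
Proof. by rewrite -opprB size_polyN size_XsubC. Qed.

Lemma size_numerator c zeta i : (size (numerator c zeta i) <= pole_mult i)%N.
Proof.
case: i => [j|[k|nu]] /=; first by rewrite size_poly0.
  by rewrite size_polyC leq_b1.
by rewrite size_comp_poly2 ?size_subCX ?size_poly.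
Qed.

Lemma sum_nat1E (V : nmodType) (F : nat -> V) n :
  \sum_(1 <= i < n.+1) F i = \sum_(j < n) F j.+1.
Proof. by rewrite big_add1 big_mkord. Qed.

(** Clearing denominators turns equalities of polar parts into polynomial identities, where
    [partial_fractions_eq0] applies. *)
Lemma polar_part_horner c zeta x : D.[x] != 0 ->
  D.[x] * polar_part alpha beta mult c zeta x =
  (\sum_i numerator c zeta i * N i).[x].
Proof.
move=> Dx; have term i : (numerator c zeta i * N i).[x] =
    D.[x] * ((numerator c zeta i).[x] / (pole i - x) ^+ pole_mult i).
  rewrite {1}(cofactorE i) !hornerM horner_exp hornerD hornerN hornerC hornerX.
  have : (pole i - x) ^+ pole_mult i != 0 by rewrite expf_neq0 // pole_neq.
  by move: (_ ^+ _) => w w0; field.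
rewrite horner_sum (eq_bigr _ (fun i _ => term i)) -mulr_sumr; congr (_ * _).
rewrite !big_sumType /= big1 ?add0r; last by move=> j _; rewrite horner0 mul0r.
congr (_ + _); first by apply: eq_bigr => k _; rewrite hornerC expr1.
apply: eq_bigr => nu _; rewrite sum_nat1E horner_comp horner_poly mulr_suml.
apply: eq_bigr => j _; rewrite !hornerE.
have w0 : beta nu - x != 0 by exact: (pole_neq (inr (inr nu)) Dx).
rewrite addn1 subnSK // -mulrA; congr (_ * _).
have -> : (beta nu - x) ^+ mult nu =
    (beta nu - x) ^+ (mult nu - j) * (beta nu - x) ^+ j.
  by rewrite -exprD subnK // ltnW.
by rewrite invfM mulrCA divff ?mulr1 ?expf_neq0.
Qed.

Lemma polar_part_uniq (T T' : {poly C}) c c' zeta zeta' :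
  (forall x, D.[x] != 0 -> `|x| <= 1 ->
     T.[x] + polar_part alpha beta mult c zeta x =
     T'.[x] + polar_part alpha beta mult c' zeta' x) ->
  [/\ T' = T, forall k, c' k = c k &
      forall nu i, (1 <= i <= mult nu)%N -> zeta' nu i = zeta nu i].
Proof.
move=> eqF.
pose A i := numerator c' zeta' i - numerator c zeta i.
have eq0 : (T' - T) * D + \sum_i A i * N i = 0.
  apply: (poly_eq0_harmonic D_neq0) => n Dx.
  have x1 : `|n.+1%:R^-1 : C| <= 1.
    by rewrite normfV normr_nat invf_le1 ?ltr0n // ler1n.
  have := eqF _ Dx x1; set x := n.+1%:R^-1 in Dx *.
  rewrite (eq_bigr (fun i => numerator c' zeta' i * N i
                             - numerator c zeta i * N i)); last first.
    by move=> i _; rewrite mulrBl.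
  rewrite sumrB !(hornerD, hornerN, hornerM) -!polar_part_horner // => E.
  rewrite mulrC -mulrBr -mulrDr addrACA -opprD -E subrr mulr0 //.
have sA i : (size (A i) <= pole_mult i)%N.
  by rewrite (leq_trans (size_polyD _ _)) // geq_max size_polyN !size_numerator.
have [T0 A0] := partial_fractions_eq0 D_neq0 cofactorE cofactor_pole pole_inj
  sA eq0.
split.
- by apply/eqP; rewrite -subr_eq0 T0.
- move=> k; have /eqP := A0 (inr (inl k)).
  by rewrite subr_eq0 => /eqP/polyC_inj.
- move=> nu [//|j] jm; have /eqP := A0 (inr (inr nu)).
  (* Substituting the degree-one polynomial [beta nu - X] is injective, so the [zeta] can be read
     off as coefficients. *)
  rewrite /A /= -comp_polyB comp_poly2_eq0 ?size_subCX // subr_eq0 => /eqP/polyP/(_ j).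
  by rewrite !coef_poly (andP jm).2.
Qed.

Lemma cofactor_neq0_off_root i x : D.[x] != 0 -> (N i).[x] != 0.
Proof. by rewrite (cofactorE i) hornerM mulf_eq0 negb_or => /andP[]. Qed.

Lemma horner_sum_cofactor (A : index -> {poly C}) i :
  (\sum_j A j * N j).[pole i] = (A i).[pole i] * (N i).[pole i].
Proof.
rewrite horner_sum (bigD1 i) //= hornerM big1 ?addr0 // => j ji.
have := pole_dvd_cofactor cofactorE pole_inj (i := i) (j := j).
rewrite eq_sym ji pole_dvdE => /(_ isT) N_dvd.
suff /rootP-> : root (A j * N j) (pole i) by [].
rewrite -dvdp_XsubCl dvdp_mull // (dvdp_trans _ N_dvd) //.
by rewrite -(prednK (pole_mult_gt0 i)) exprS dvdp_mulr.
Qed.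

Lemma near_nonroot x : \forall y \near x^', D.[y] != 0.
Proof.
have [r [q [qx DE]]] : exists r q, q.[x] != 0 /\ D = q * ('X - x%:P) ^+ r.
  by have [r [q]] := multiplicity_XsubC D x; rewrite D_neq0 => qx ->; exists r, q.
near=> y; rewrite DE hornerM horner_exp !hornerE mulf_neq0 //.
  by near: y; apply: nbhs_dnbhs; exact: near_horner_neq0.
rewrite expf_neq0 // subr_eq0; near: y; exact: nbhs_dnbhs_neq.
Unshelve. all: by end_near. Qed.

Lemma polar_expansion (Lambda : {poly C}) :
  (forall j, root Lambda (z j)) ->
  exists c zeta, [/\
    forall x, D.[x] != 0 ->
      Lambda.[x] / D.[x] =
        (Lambda %/ D).[x] + polar_part alpha beta mult c zeta x,
    simple_coefs alpha Lambda D c &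
    multiple_coefs beta mult Lambda D zeta].
Proof.
move=> Lambda_z.
have [A sA LE] := partial_fractions D_neq0 cofactorE cofactor_pole pole_inj
  poles_dvd Lambda.
have D_pole i : D.[pole i] = 0.
  rewrite {1}(cofactorE i) hornerM horner_exp hornerD hornerN hornerC hornerX.
  by rewrite subrr expr0n eqn0Ngt pole_mult_gt0 mul0r.
have L_pole i : Lambda.[pole i] = (A i).[pole i] * (N i).[pole i].
  by rewrite LE hornerD hornerM D_pole mulr0 add0r horner_sum_cofactor.
have N_neq0 i : (N i).[pole i] != 0 by exact: cofactor_pole.
pose c k := (A (inr (inl k))).[alpha k].
(* The Taylor coefficient of the numerator at [(beta nu - x) ^ (i - 1)]; dividing by the power
   [mult nu] gives the exponent [mult nu - i + 1] of [polar_part]. *)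
pose zeta nu i := (-1) ^+ i.-1 * (A (inr (inr nu)))^`N(i.-1).[beta nu].
have AE i : A i = numerator c zeta i.
  case: i => [j|[k|nu]] /=.
  - have /size1_polyC AjE := sA (inl j).
    (* The numerator at [z j] is a constant; its product with the nonzero value of the cofactor is
       [Lambda.[z j] = 0]. *)
    have := L_pole (inl j); rewrite (rootP (Lambda_z j)) => /esym/eqP.
    by rewrite mulf_eq0 (negbTE (N_neq0 _)) orbF AjE hornerC => /eqP->.
  - have /size1_polyC AkE := sA (inr (inl k)).
    by rewrite /c AkE hornerC.
  - apply/eqP; rewrite -subr_eq0; apply/eqP.
    apply: (@poly_eq0_harmonic _ 1) => [|n _]; first exact: oner_neq0.
    rewrite hornerD hornerN horner_comp horner_poly !hornerE.
    by rewrite (horner_taylor (beta nu) _ (sA (inr (inr nu)))) subrr.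
exists c, zeta; split.
- move=> x Dx; rewrite {1}LE hornerD hornerM mulrDl mulfK //; congr (_ + _).
  rewrite (eq_bigr _ (fun i _ => congr1 (fun q => q * N i) (AE i))).
  by rewrite -polar_part_horner // mulrAC divff ?mul1r.
- move=> k; have Lk := L_pole (inr (inl k)); have Nk := N_neq0 (inr (inl k)).
  have DE := cofactorE (inr (inl k)).
  (* From [D = (alpha k - X) N] comes [D' = - N] at [alpha k], whence the minus sign in [c k]. *)
  rewrite /= in Lk Nk DE; rewrite Lk {1}DE expr1 derivM derivB derivC derivX sub0r.
  rewrite hornerD !hornerM !hornerD !hornerN !hornerC hornerX subrr mul0r addr0.
  by rewrite mulN1r invrN mulrN opprK mulfK.
- move=> nu i /andP[i1 im] g.
  pose Nnu := N (inr (inr nu)); pose Anu := A (inr (inr nu)).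
  have DE := cofactorE (inr (inr nu)); rewrite /= -/Nnu in DE.
  (* Off the zeros of [D], [g] is [Lambda / Nnu], that is [Anu] plus a fraction vanishing to order
     [mult nu], which derivatives of order [i - 1 < mult nu] cannot see at [beta nu]. *)
  have [q qE] : exists q, Lambda = Anu * Nnu + q * ((beta nu)%:P - 'X) ^+ mult nu.
    have /dvdpP[q qE] : ((beta nu)%:P - 'X) ^+ mult nu %| Lambda - Anu * Nnu.
      rewrite {1}LE -addrA dvdp_add ?dvdp_mull //.
        by rewrite {1}DE dvdp_mulr.
      exact: (pole_dvd_sum cofactorE pole_inj A (inr (inr nu))).
    by exists q; rewrite -qE addrCA subrr addr0.
  have gE x : D.[x] != 0 ->
      g x = Anu.[x] + (q * ((beta nu)%:P - 'X) ^+ mult nu).[x] / Nnu.[x].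
    move=> Dx; have Nx : Nnu.[x] != 0 := cofactor_neq0_off_root (inr (inr nu)) Dx.
    have w0 : beta nu - x != 0 by exact: (pole_neq (inr (inr nu)) Dx).
    rewrite /g qE {1}DE !(hornerD, hornerN, hornerM) !horner_exp.
    rewrite hornerD hornerN hornerC hornerX.
    set w := _ ^+ _; have ww : w != 0 by rewrite expf_neq0.
    by field; rewrite ww Nx.
  have B_dvd : ('X - (beta nu)%:P) ^+ mult nu %|
      q * ((beta nu)%:P - 'X) ^+ mult nu.
    by rewrite -pole_dvdE dvdp_mull.
  have im' : (i - 1 < mult nu)%N by rewrite subn1 prednK.
  have g_cvg := cvg_derive1n_rational (@cofactor_neq0_off_root (inr (inr nu)))
    B_dvd gE (N_neq0 (inr (inr nu))) (near_nonroot (beta nu)) im'.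
  split; first by apply/cvg_ex; eexists; exact: g_cvg.
  rewrite (cvg_lim (@norm_hausdorff _ _) g_cvg) subn1 /zeta -/Anu.
  rewrite nderivn_def hornerMn -[X in _ = _ / _ * X]mulr_natr.
  by rewrite mulrAC mulrA mulfK // pnatr_eq0 -lt0n fact_gt0.
Qed.

Lemma polar_coef_gf (T : {poly C}) c zeta x : `|x| <= 1 ->
  series (fun n => (T`_n + polar_coef alpha beta mult c zeta n) * x ^+ n) @ \oo
    --> T.[x] + polar_part alpha beta mult c zeta x.
Proof.
move=> x1; under [X in series X]eq_fun do rewrite mulrDl.
apply: cvg_seriesD; first exact: cvg_series_poly.
rewrite /polar_coef; under [X in series X]eq_fun do rewrite mulrDl !mulr_suml.
apply: cvg_seriesD; apply: cvg_series_sum => i _.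
  have := @cvg_series_pole _ (@cplx_harmonic_cvg0 R) 0 (c i) (alpha i) x
    (le_lt_trans x1 (alpha_gt1 i)).
  by under [X in series X]eq_fun do rewrite add0n bin0 mul1r.
under [X in series X]eq_fun do rewrite sum_nat1E mulr_suml.
rewrite sum_nat1E; apply: cvg_series_sum => j _.
have := @cvg_series_pole _ (@cplx_harmonic_cvg0 R) (mult i - j.+1) (zeta i j.+1)
  (beta i) x (le_lt_trans x1 (beta_gt1 i)).
rewrite addn1; under [X in series X]eq_fun => n.
  (* The truncated subtractions may be reordered since [j < mult i]. *)
  rewrite (_ : (mult i - j.+1 + n)%N = (mult i + n - j.+1)%N); last first.
    by rewrite addnBAC.
  rewrite (_ : (mult i + n - j.+1).+1 = (mult i + n + 1 - j.+1)%N); last first.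
    by rewrite addn1 subSn // ltn_addr.
  over.
by [].
Qed.

End QueuePartialFractions.

Theorem mainTheorem5 (R : realType) (Q : bulk_queue R) (P : epoch -> R)
  (L1 M1 m : nat) (Lambda D : {poly cplx R})
  (beta : 'I_m -> cplx R) (mult : 'I_m -> nat)
  (alpha : 'I_(M1 - qb Q - \sum_(nu < m) mult nu) -> cplx R)
  (z : 'I_(qb Q) -> cplx R) :
  let p n := P (n, Some (qb Q)) in
  steady_state Q P ->
  size Lambda = L1.+1 -> size D = M1.+1 ->
  has_gf p [set x | root D x] (fun x => Lambda.[x] / D.[x]) ->
  (* the zeros of [D] in the closed unit disk *)
  injective z ->
  (forall x, root D x /\ `|x| <= 1 <-> exists j, x = z j) ->
  (forall j, mup (z j) D = 1%N) ->
  (forall j, root Lambda (z j)) ->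
  (* the zeros of [D] outside the closed unit disk *)
  injective alpha -> injective beta ->
  (forall x, root D x /\ 1 < `|x| <->
     (exists k, x = alpha k) \/ (exists nu, x = beta nu)) ->
  (forall k, mup (alpha k) D = 1%N) ->
  (forall nu, (1 < mult nu)%N /\ mup (beta nu) D = mult nu) ->
  ((M1 <= L1)%N ->
    exists tau c zeta,
      [/\ has_gf p set0 (fun x => \sum_(0 <= i < (L1 - M1).+1) tau i * x ^+ i
                                  + polar_part alpha beta mult c zeta x),
          (forall tau' c' zeta',
             has_gf p set0 (fun x =>
               \sum_(0 <= i < (L1 - M1).+1) tau' i * x ^+ i
               + polar_part alpha beta mult c' zeta' x) ->
             [/\ (forall i, (i <= L1 - M1)%N -> tau' i = tau i),
                 (forall k, c' k = c k) &
                 (forall nu i, (1 <= i <= mult nu)%N ->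
                    zeta' nu i = zeta nu i)]),
          [/\ \poly_(i < (L1 - M1).+1) tau i = Lambda %/ D,
              simple_coefs alpha Lambda D c &
              multiple_coefs beta mult Lambda D zeta],
          (forall n, (n <= L1 - M1)%N ->
             toC (p n) = tau n + polar_coef alpha beta mult c zeta n) &
          (forall n, (L1 - M1 < n)%N ->
             toC (p n) = polar_coef alpha beta mult c zeta n)]) /\
  ((L1 < M1)%N ->
    exists c zeta,
      [/\ has_gf p set0 (polar_part alpha beta mult c zeta),
          (forall c' zeta',
             has_gf p set0 (polar_part alpha beta mult c' zeta') ->
             (forall k, c' k = c k) /\
             (forall nu i, (1 <= i <= mult nu)%N ->
                zeta' nu i = zeta nu i)),
          simple_coefs alpha Lambda D c,
          multiple_coefs beta mult Lambda D zeta &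
          (forall n, toC (p n) = polar_coef alpha beta mult c zeta n)]).
Proof.
move=> p _ sL sD p_gf z_inj root_in mup_z Lambda_z alpha_inj beta_inj root_out
  mup_alpha mup_beta.
have D_neq0 : D != 0 by rewrite -size_poly_eq0 sD.
have [c [zeta [LDE c_coefs zeta_coefs]]] := polar_expansion D_neq0 z_inj
  alpha_inj beta_inj root_in root_out mup_z mup_alpha mup_beta Lambda_z.
have gf_coef x : `|x| <= 1 ->
    series (fun n => ((Lambda %/ D)`_n + polar_coef alpha beta mult c zeta n)
                     * x ^+ n) @ \oo -->
      (Lambda %/ D).[x] + polar_part alpha beta mult c zeta x.
  exact: polar_coef_gf.
have pE : forall n,
    toC (p n) = (Lambda %/ D)`_n + polar_coef alpha beta mult c zeta n.
  apply: (power_series_uniq (@cplx_harmonic_cvg0 R)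
    (F := fun x => Lambda.[x] / D.[x]) D_neq0) => n x Dx.
  have x1 : `|x| <= 1 by rewrite normfV normr_nat invf_le1 ?ltr0n // ler1n.
  split; first exact: p_gf x1 (elimN idP Dx).
  by rewrite LDE //; exact: gf_coef.
(* [p_gf] says nothing at the zeros of [D]; once the coefficients are known, the expansion holds at
   these points of the disk too. *)
have p_gf0 : has_gf p set0
    (fun x => (Lambda %/ D).[x] + polar_part alpha beta mult c zeta x).
  by move=> x x1 _; under eq_fun do rewrite pE; exact: gf_coef.
have gf_uniq T' c' zeta' :
    has_gf p set0 (fun x => T'.[x] + polar_part alpha beta mult c' zeta' x) ->
    [/\ T' = Lambda %/ D, forall k, c' k = c k &
        forall nu i, (1 <= i <= mult nu)%N -> zeta' nu i = zeta nu i].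
  move=> p_gf'; apply: (polar_part_uniq D_neq0 z_inj alpha_inj beta_inj root_in
    root_out mup_z mup_alpha mup_beta) => x _ x1.
  exact: (cvg_unique (@norm_hausdorff _ _) (p_gf0 x x1 id) (p_gf' x x1 id)).
split=> [ML | LM].
  have sT : size (Lambda %/ D) = (L1 - M1).+1.
    by rewrite size_divp // sL sD /= subSn.
  have polyE (tau : nat -> cplx R) x :
      \sum_(0 <= i < (L1 - M1).+1) tau i * x ^+ i =
      (\poly_(i < (L1 - M1).+1) tau i).[x].
    by rewrite horner_poly big_mkord.
  have TE : \poly_(i < (L1 - M1).+1) (Lambda %/ D)`_i = Lambda %/ D.
    by rewrite -sT coefK.
  exists (fun i => (Lambda %/ D)`_i), c, zeta; split.
  - by move=> x x1 x0; rewrite polyE TE; exact: p_gf0.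
  - move=> tau' c' zeta' p_gf'; have [] := gf_uniq
      (\poly_(i < (L1 - M1).+1) tau' i) c' zeta'.
      by move=> x x1 x0; rewrite -polyE; exact: p_gf'.
    move=> T'E c'E zeta'E; split; [move=> i iLM|exact: c'E|exact: zeta'E].
    by rewrite -T'E coef_poly ltnS iLM.
  - by split; [exact: TE|exact: c_coefs|exact: zeta_coefs].
  - by move=> n _; rewrite pE.
  - by move=> n nLM; rewrite pE nth_default ?add0r ?sT.
have T0 : Lambda %/ D = 0 by rewrite divp_small // sL sD.
rewrite {}T0 in pE p_gf0 gf_uniq.
exists c, zeta; split.
- by move=> x x1 x0; have := p_gf0 x x1 x0; rewrite horner0 add0r.
- move=> c' zeta' p_gf'; have [|_ c'E zeta'E] := gf_uniq 0 c' zeta'.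
    by move=> x x1 x0; rewrite horner0 add0r; exact: p_gf'.
  by split; [exact: c'E|exact: zeta'E].
- exact: c_coefs.
- exact: zeta_coefs.
- by move=> n; rewrite pE coef0 add0r.
Qed.
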